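(* Let $\mathcal{A}=\mathcal{B}(\mathcal{X})$ be the Borel $\sigma$-algebra of the metric space $\mathcal{X}$, let $\varepsilon>0$, and assume that for every $x\in\operatorname{supp}(\rho)$: (1) $\mathfrak{m}_x(\mathcal{X}\setminus B_\varepsilon(x))=0$; (2) $B_\varepsilon(x)\subseteq\operatorname{supp}(\mathfrak{m}_x)$; (3) for every $x'\in\operatorname{supp}(\rho)$ the restriction $\mathfrak{m}_{x'}\lfloor_{B_\varepsilon(x)}$ is absolutely continuous with respect to $\mathfrak{m}_x$; (4) the restriction $\rho\lfloor_{B_\varepsilon(x)}$ is absolutely continuous with respect to $\mathfrak{m}_x$. Let $\Psi_p(t):=\min\{t/p,1\}$ for $p>0$. Suppose that for every $p>0$ the set $A_p$ is a minimizer of $\mathrm{ProbR}_{\Psi_p}$ over $\mathcal{A}$, and that, as $p\to0$, $A_p$ converges to a set $A\in\mathcal{A}$ in the weak-* topology of $L^\infty(\mathcal{X};\nu)$ (i.e. $\mathbf{1}_{A_p}\overset{*}{\rightharpoonup}\mathbf{1}_A$). Then there is a set $A'\in\mathcal{A}$ with $\nu(A'\triangle A)=0$ such that $A'$ is a minimizer of $\mathrm{R}_{\mathrm{adv}}$ over $\mathcal{A}$. The same statement is true with $\mathrm{ProbR}_{\Psi_p}$ replaced by $\mathrm{R}_{\Psi_p}$.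
   Context: Setting: $\mathcal{X}$ is a metric space, $B_\varepsilon(x)$ the open ball of radius $\varepsilon$ around $x$, $\mathcal{A}=\mathcal{B}(\mathcal{X})$, and $\mu$ a probability measure on $(\mathcal{X}\times\{0,1\},\mathcal{A}\otimes 2^{\{0,1\}})$. For $i\in\{0,1\}$ put $\rho_i(B):=\mu(B\times\{i\})$, and $\rho:=\rho_0+\rho_1$. $\{\mathfrak{m}_x\}_{x\in\mathcal{X}}$ is a family of Borel probability measures on $\mathcal{X}$ with $x\mapsto\mathfrak{m}_x(B)$ measurable for every $B\in\mathcal{A}$. $\operatorname{supp}$ denotes the support of a Borel measure (the set of points all of whose open neighborhoods have positive measure); $\rho$ is concentrated on its support, $\rho(\mathcal{X}\setminus\operatorname{supp}(\rho))=0$ (automatic if $\mathcal{X}$ is separable). Define $\nu(B):=\frac12\int_{\mathcal{X}}\mathfrak{m}_x(B)\,d\rho(x)+\frac12\rho(B)$ for $B\in\mathcal{A}$; weak-* convergence in $L^\infty(\mathcal{X};\nu)$ is convergence of integrals against every $\varphi\in L^1(\mathcal{X};\nu)$. For $\Psi:[0,1]\to[0,1]$ and $A\in\mathcal{A}$ (with $A^c=\mathcal{X}\setminus A$): $$\mathrm{R}_\Psi(A):=\int_{\mathcal{X}}\Psi(\mathfrak{m}_x(A))\,d\rho_0(x)+\int_{\mathcal{X}}\Psi(\mathfrak{m}_x(A^c))\,d\rho_1(x),$$ $$\mathrm{ProbR}_\Psi(A):=\rho_0(A)+\rho_1(A^c)+\int_{A^c}\Psi(\mathfrak{m}_x(A))\,d\rho_0(x)+\int_{A}\Psi(\mathfrak{m}_x(A^c))\,d\rho_1(x),$$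 $$\mathrm{R}_{\mathrm{adv}}(A):=\int_{\mathcal{X}}\sup_{\tilde x\in B_\varepsilon(x)}\mathbf{1}_A(\tilde x)\,d\rho_0(x)+\int_{\mathcal{X}}\sup_{\tilde x\in B_\varepsilon(x)}\mathbf{1}_{A^c}(\tilde x)\,d\rho_1(x).$$ *)

(* Defs.v *)
From HB Require Import structures.
From mathcomp Require Import all_boot all_order all_algebra.
From mathcomp Require Import all_classical all_reals all_analysis measurable_realfun.

Set Implicit Arguments.
Unset Strict Implicit.
Unset Printing Implicit Defensive.

Import Order.TTheory GRing.Theory Num.Theory.
Import numFieldNormedType.Exports.

Local Open Scope classical_set_scope.
Local Open Scope ring_scope.

(* The library's measurable types are pointed. For a space that carries a
   probability measure, hence is nonempty, the base point costs nothing. *)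
#[short(type="pmetricType")]
HB.structure Definition PointedMetric (K : numDomainType) :=
  {M of Pointed M & Metric K M}.

(* [borel X] is the metric space [X] itself, equipped with B(X). *)
Definition borel (R : realType) (X : pmetricType R) : Type := X.

HB.instance Definition _ (R : realType) (X : pmetricType R) :=
  PointedMetric.copy (borel X) X.
HB.instance Definition _ (R : realType) (X : pmetricType R) :=
  @isMeasurable.Build (sigma_display (@open X)) (borel X) <<s @open X >>
    (@sigma_algebra0 _ setT _) (@sigma_algebraC _ _)
    (@sigma_algebra_bigcup _ setT _).

Section borel_sets.
Context (R : realType) (X : pmetricType R).
Implicit Types (x : borel X) (e : R).

Lemma measurable_open (U : set (borel X)) : open U -> measurable U.
Proof. exact: sub_sigma_algebra. Qed.

Lemma metric_ball_open x e : open (ball x e).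
Proof.
rewrite openE => y; rewrite ballEmdist/= => xy.
apply/nbhs_ballP; exists (e - mdist x y); first by rewrite /= subr_gt0.
move=> z; rewrite !ballEmdist/= ltrBrDl => yz.
exact: le_lt_trans (metric_triangle _ _ _) yz.
Qed.

Lemma measurable_metric_ball x e : measurable (ball x e).
Proof. by apply: measurable_open; exact: metric_ball_open. Qed.

Definition msupport (m : set (borel X) -> \bar R) : set (borel X) :=
  [set x | forall U, open U -> U x -> (0 < m U)%E].

End borel_sets.

(* Weak-* convergence in L^oo(nu) of the family f along the filter F;
   L^1(nu) is represented by real-valued nu-integrable functions. *)
Definition weak_star_cvg d (T : measurableType d) (R : realType)
    (nu : {measure set T -> \bar R}) (I : Type) (F : set_system I)
    (f : I -> T -> R) (g : T -> R) : Prop :=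
  forall phi : T -> R, nu.-integrable setT (EFin \o phi) ->
    (\int[nu]_x (phi x * f i x)) @[i --> F] --> (\int[nu]_x (phi x * g x) : R).

Definition is_minimizer d (T : measurableType d) (R : realType)
    (J : set T -> \bar R) (A : set T) : Prop :=
  measurable A /\ forall B, measurable B -> (J A <= J B)%E.

Section classification.
Local Open Scope ereal_scope.
Context (R : realType) (X : pmetricType R).
(* Labels {0, 1} are booleans: false is 0 and true is 1. *)
Variable mu : probability (borel X * bool)%type R.

Definition rho_ (i : bool) (B : set (borel X)) : \bar R := mu (B `*` [set i]).

Section rho_measure.
Variable i : bool.

Let rho0 : rho_ i set0 = 0. Proof. by rewrite /rho_ set0X measure0. Qed.

Let rho_ge0 B : 0 <= rho_ i B. Proof. exact: measure_ge0. Qed.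

Let rho_sigma_additive : semi_sigma_additive (rho_ i).
Proof.
move=> F mF tF mUF; rewrite /rho_ setX_bigcupl.
apply: measure_semi_sigma_additive.
- by move=> k; exact: measurableX.
- apply/trivIsetP => j k _ _ jk; rewrite -setXI.
  by move/trivIsetP : tF => /(_ j k Logic.I Logic.I jk) ->; rewrite set0X.
- by rewrite -setX_bigcupl; exact: measurableX.
Qed.

HB.instance Definition _ := isMeasure.Build _ _ _ (rho_ i)
  rho0 rho_ge0 rho_sigma_additive.

End rho_measure.

Definition rho : {measure set (borel X) -> \bar R} :=
  measure_add (rho_ false) (rho_ true).

Variable m : R.-pker (borel X) ~> (borel X).

Definition nu (B : set (borel X)) : \bar R :=
  (2^-1)%:E * \int[rho]_x m x B + (2^-1)%:E * rho B.

Let nu0 : nu set0 = 0.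
Proof.
by rewrite /nu measure0 mule0 adde0 integral0_eq ?mule0.
Qed.

Let nu_ge0 B : 0 <= nu B.
Proof.
by rewrite /nu adde_ge0// mule_ge0// ?lee_fin ?invr_ge0// integral_ge0.
Qed.

Let nu_sigma_additive : semi_sigma_additive nu.
Proof.
move=> F mF tF mUF.
have mm k : measurable_fun setT (m ^~ (F k)) by exact: measurable_kernel.
have -> : nu (\bigcup_k F k) = \sum_(k <oo) nu (F k).
  rewrite /nu nneseriesD; last 2 first.
  - by move=> k _ _; rewrite mule_ge0// ?lee_fin ?invr_ge0// integral_ge0.
  - by move=> k _ _; rewrite mule_ge0// lee_fin invr_ge0.
  rewrite !nneseriesZl//; last by move=> k _; rewrite integral_ge0.
  rewrite -integral_nneseries//.
  congr (_ * _ + _ * _); last exact: measure_semi_bigcup.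
  by apply: eq_integral => x _; exact: measure_semi_bigcup.
apply: is_cvg_ereal_nneg_natsum => k _; exact: nu_ge0.
Qed.

HB.instance Definition _ := isMeasure.Build _ _ _ nu
  nu0 nu_ge0 nu_sigma_additive.

(* Only the values of Psi on [0, 1] matter. *)
Variable Psi : R -> R.

Definition Risk (A : set (borel X)) : \bar R :=
  \int[rho_ false]_x (Psi (fine (m x A)))%:E +
  \int[rho_ true]_x (Psi (fine (m x (~` A))))%:E.

Definition ProbRisk (A : set (borel X)) : \bar R :=
  rho_ false A + rho_ true (~` A) +
  \int[rho_ false]_(x in ~` A) (Psi (fine (m x A)))%:E +
  \int[rho_ true]_(x in A) (Psi (fine (m x (~` A))))%:E.

Variable eps : R.

Definition AdvRisk (A : set (borel X)) : \bar R :=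
  \int[rho_ false]_x ereal_sup [set (\1_A y : R)%:E | y in ball x eps] +
  \int[rho_ true]_x ereal_sup [set (\1_(~` A) y : R)%:E | y in ball x eps].

End classification.

Definition Psi_ (R : realType) (p t : R) : R := Num.min (t / p) 1.

(* Main.v *)
Require Import Defs.
From HB Require Import structures.
From mathcomp Require Import all_boot all_order all_algebra finmap.
From mathcomp Require Import all_classical all_reals all_analysis measurable_realfun.

Set Implicit Arguments.
Unset Strict Implicit.
Unset Printing Implicit Defensive.

Import Order.TTheory GRing.Theory Num.Theory.
Import numFieldNormedType.Exports.

Local Open Scope classical_set_scope.
Local Open Scope ring_scope.

(* Let [S] be the support of [rho]. As [p] tends to [0], [Psi_p] increases to
   the indicator of [t > 0], so the natural limit functional is
     [R0 A = rho_0 {x | m_x(A) > 0} + rho_1 {x | m_x(A^c) > 0}].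
   For [x] in [S], [m_x] is absolutely continuous with respect to [nu], so the
   weak-* convergence gives [m_x(A_p) --> m_x(A)], and Fatou's lemma yields
   [R0 A <= liminf Risk_p(A_p)]. On the other hand
   [Risk_p <= ProbRisk_p <= AdvRisk], so minimality of [A_p] gives
   [R0 A <= AdvRisk B] for every [B]. Finally [A] is modified on a [nu]-null
   set: remove from it the balls around the [x] in [S] with [m_x(A) = 0] and
   add those around the [x] in [S] with [m_x(A^c) = 0]. Each of these two
   unions of balls reduces to a countable one as [S] is separable, and they
   are disjoint; the modified set [A'] satisfies [AdvRisk A' <= R0 A]. *)

(** * Countability from finite measure, and separability of supports *)

(** Only finitely many of the disjoint sets can have measure above [1/(n+1)], and positivity puts
    every index in one of these finite classes. *)
Lemma countable_trivIset_pos d (T : measurableType d) (R : realType)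
    (P : {measure set T -> \bar R}) (I : choiceType) (D : set I)
    (B : I -> set T) :
  (P setT < +oo)%E -> (forall i, measurable (B i)) -> trivIset D B ->
  (forall i, D i -> 0 < P (B i))%E -> countable D.
Proof.
move=> Pfin mB tB posB.
pose F n := [set i | D i /\ (n.+1%:R^-1%:E < P (B i))%E].
have PTfin : P setT \is a fin_num by rewrite ge0_fin_numE.
have finF n : finite_set (F n).
  (* [M] disjoint sets of measure above [1/(n+1)] would together exceed [P setT]. *)
  pose M := (Num.truncn (fine (P setT) * n.+1%:R)).+1.
  apply: contrapT => /(infinite_set_fset M)[/= C CF Ccard].
  have := truncnS_gt (fine (P setT) * n.+1%:R); apply/negP; rewrite -leNgt.
  rewrite (@le_trans _ _ #|` C|%:R) ?ler_nat// -ler_pdivrMr ?ltr0n//.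
  rewrite -lee_fin fineK//.
  apply: (@le_trans _ _ (P (\bigcup_(i in [set` C]) B i))); last first.
    apply: le_measure; rewrite ?inE//.
    by apply: fin_bigcup_measurable.
  rewrite measure_fin_bigcup//; last first.
    by apply: sub_trivIset tB => i /CF[].
  rewrite fsbig_finite//= set_fsetK.
  rewrite (@le_trans _ _ (\sum_(i <- C) n.+1%:R^-1%:E)%E)//.
    rewrite sumEFin lee_fin big_const_seq count_predT iter_addr addr0.
    by rewrite mulr_natl.
  rewrite big_seq [in leRHS]big_seq; apply: lee_sum => i.
  by move=> /CF[_ /ltW].
have -> : D = \bigcup_n F n.
  apply/seteqP; split=> [i Di|i [n _ []//]].
  have [r [r0 rB]] : exists r : R, 0 < r /\ (r%:E < P (B i))%E.
    have := posB _ Di; case: (P (B i)) => [s| |//]; rewrite ?lte_fin => s0.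
      exists (s / 2); rewrite divr_gt0// lte_fin ltr_pdivrMr//.
      by rewrite mulr2n mulrDr mulr1 ltrDl.
    by exists 1; rewrite ltr01 ltry.
  exists (Num.truncn r^-1) => //; split => //; apply: lt_trans rB.
  by rewrite lte_fin invf_plt ?posrE// truncnS_gt.
apply: bigcup_countable => // n _; exact: finite_set_countable.
Qed.

(* Disjoint balls centred in the support are countably many; [D] collects the
   centres of maximal disjoint families of balls of radii [1/(n+1)]. *)
Lemma msupport_separable (R : realType) (X : pmetricType R)
    (P : {measure set (borel X) -> \bar R}) (E : set (borel X)) :
  (P setT < +oo)%E -> E `<=` msupport P ->
  exists D : set (borel X), [/\ countable D, D `<=` E &
    forall x r, E x -> 0 < r -> exists2 y, D y & ball x r y].
Proof.
move=> Pfin EP.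
pose B n (x : borel X) := ball x (n.+1%:R^-1 : R).
pose D_ n := sval (ex_maximal_disjoint_subcollection (B n) E).
have DE n : D_ n `<=` E.
  by rewrite /D_; case: ex_maximal_disjoint_subcollection => ? [].
have Dtriv n : trivIset (D_ n) (B n).
  by rewrite /D_; case: ex_maximal_disjoint_subcollection => ? [].
have Dmax n C : D_ n `<` C -> C `<=` E -> ~ trivIset C (B n).
  by rewrite /D_; case: ex_maximal_disjoint_subcollection => ? [? ?]; exact.
exists (\bigcup_n D_ n); split; last 2 first.
- by move=> x [n _ /DE].
- move=> x r Ex r0.
  (* This [n] makes [2/(n+1) < r]: if the balls of radius [1/(n+1)] around [x] and [y] meet, then
     [y] lies within [r] of [x]. With no such [y], the point [x] could be added to the maximal
     family. *)
  pose n := Num.truncn (2 * r^-1).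
  have nr : n.+1%:R^-1 + n.+1%:R^-1 < r.
    rewrite -mulr2n -[_ *+ 2]mulr_natl ltr_pdivrMr ?ltr0n// mulrC.
    by rewrite -ltr_pdivrMr// truncnS_gt.
  apply: contrapT => noy.
  have far y : D_ n y -> ball x r y -> False.
    by move=> Dy xy; apply: noy; exists y => //; exists n.
  have Dx : ~ D_ n x by move=> /far; apply; exact: ballxx.
  apply: (Dmax n (x |` D_ n)).
  + split; first by move=> ? ?; right.
    by move=> /(_ x (or_introl erefl)).
  + by move=> y [->//|/DE].
  + have disj y : D_ n y -> ~ (B n x `&` B n y !=set0).
      move=> Dy [z [xz yz]]; apply: (far y Dy).
      apply: le_ball (ltW nr) _ _; apply: ball_triangle xz _; exact: ball_sym.
    move=> y z [->|Dy] [->|Dz]//.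
    * by move=> /(disj _ Dz).
    * by rewrite setIC => /(disj _ Dy).
    * exact: Dtriv.
- apply: bigcup_countable => // n _.
  apply: (@countable_trivIset_pos _ _ _ P _ _ (B n)) => //.
    by move=> x; exact: measurable_metric_ball.
  move=> x /DE/EP; apply; first exact: metric_ball_open.
  by apply: ballxx; rewrite invr_gt0.
Qed.

(* [P] has a density [f] in [L^1(Q)], which serves as a test function. *)
Lemma weak_star_cvg_null_dominates d (T : measurableType d) (R : realType)
    (P Q : {measure set T -> \bar R}) (I : Type) (F : set_system I)
    (A_ : I -> set T) (A : set T) : Filter F ->
  (P setT < +oo)%E -> (Q setT < +oo)%E -> P `<< Q ->
  (\forall i \near F, measurable (A_ i)) -> measurable A ->
  weak_star_cvg Q F (fun i => \1_(A_ i)) \1_A ->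
  fine (P (A_ i)) @[i --> F] --> fine (P A).
Proof.
move=> FF PT QT PQ mA_ mA AA.
(* The density is taken between bundled finite measures; restriction to the whole space bundles a
   measure without changing it. *)
have finite (M : {measure set T -> \bar R}) : (M setT < +oo)%E ->
    exists M' : {finite_measure set T -> \bar R}, M = M'.
  move=> MT; exists (mfrestr measurableT MT); apply: eq_measure.
  by apply/funext => B; rewrite -[in LHS](setIT B).
have [P' PE] := finite P PT; have [Q' QE] := finite Q QT.
move: PQ AA; rewrite {}PE {}QE => PQ AA.
pose f := Radon_Nikodym_SigmaFinite.f P' Q'.
have fE x : (fine (f x))%:E = f x.
  by rewrite fineK// Radon_Nikodym_SigmaFinite.f_fin_num.
have PE B : measurable B ->
    fine (P' B) = (\int[Q']_x (fine (f x) * \1_B x) : R)%R.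
  move=> mB; rewrite (Radon_Nikodym_SigmaFinite.f_integral PQ mB).
  rewrite -{1}(setTI B) integral_mkcondr /Rintegral; congr fine.
  apply: eq_integral => x _; rewrite patchE indicE.
  by case: ifPn => /= _; rewrite ?mulr1 ?mulr0//= fE.
rewrite (PE _ mA).
have := AA (fine \o f); have -> : EFin \o (fine \o f) = f by apply/funext.
move=> /(_ (Radon_Nikodym_SigmaFinite.f_integrable PQ)).
apply: cvg_trans; apply: near_eq_cvg.
by apply: filterS mA_ => i /PE.
Qed.

(** * Lower limits, supports and elementary bounds on [Psi_p] *)

(** The tail infima add up to at most [u n + v n], and nonnegativity rules out an undefined sum of
    limits. *)
Lemma limn_einf_add_le (R : realType) (u v : (\bar R)^nat) (M : \bar R) :
  (forall n, 0 <= u n)%E -> (forall n, 0 <= v n)%E ->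
  (forall n, u n + v n <= M)%E -> (limn_einf u + limn_einf v <= M)%E.
Proof.
move=> u0 v0 uvM; rewrite !limn_einf_lim.
have einfs_ge0 w : (forall n, 0 <= w n)%E -> forall n, (0 <= @einfs R w n)%E.
  by move=> w0 n; apply: le_ereal_inf_tmp => _ [k _ <-].
have lim_ge0 w : (forall n, 0 <= w n)%E -> (0 <= limn (@einfs R w))%E.
  move=> w0; apply: lime_ge; first exact: is_cvg_einfs.
  by apply: nearW => n; exact: einfs_ge0.
have uv : (limn (einfs u) +? limn (einfs v))%E.
  by apply: ge0_adde_def; rewrite inE lim_ge0.
rewrite -limeD//; [|exact: is_cvg_einfs..].
apply: lime_le; first by apply: is_cvgeD => //; exact: is_cvg_einfs.
apply: nearW => n; apply: le_trans (uvM n).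
by apply: leeD; apply: ereal_inf_lbound; exists n => /=.
Qed.

Lemma measurable_fun_limn_einf d (T : measurableType d) (R : realType)
    (D : set T) (f : (T -> \bar R)^nat) :
  (forall n, measurable_fun D (f n)) ->
  measurable_fun D (fun x => limn_einf (f ^~ x)).
Proof.
move=> mf.
have mNf : measurable_fun D (fun x => limn_esup (fun n => - f n x)%E).
  by apply: measurable_fun_limn_esup => n; exact: measurableT_comp.
exact: measurableT_comp mNf.
Qed.

Lemma open_setC_msupport (R : realType) (X : pmetricType R)
    (P : set (borel X) -> \bar R) : open (~` msupport P).
Proof.
have -> : ~` msupport P =
    \bigcup_(U in [set U | open U /\ ~ (0 < P U)%E]) U.
  apply/seteqP; split=> [x|x [U [oU PU] Ux] /(_ U oU Ux)//].
  rewrite /msupport /= => /existsNP[U /not_implyP[oU /not_implyP[Ux PU]]].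
  by exists U.
by apply: bigcup_open => U [].
Qed.

Lemma measurable_setC_msupport (R : realType) (X : pmetricType R)
    (P : set (borel X) -> \bar R) : measurable (~` msupport P).
Proof. by apply: measurable_open; exact: open_setC_msupport. Qed.

Lemma Psi_bounds (R : realType) (p t : R) : 0 < p -> 0 <= t ->
  0 <= Psi_ p t <= 1.
Proof.
move=> p0 t0.
by rewrite /Psi_ le_min ge_min lexx orbT andbT ler01 andbT divr_ge0// ltW.
Qed.

Lemma Psi_0 (R : realType) (p : R) : Psi_ p 0 = 0.
Proof. by rewrite /Psi_ mul0r; apply/min_idPl. Qed.

Lemma Psi_1 (R : realType) (p t : R) : 0 < p -> p <= t -> Psi_ p t = 1.
Proof. by move=> p0 pt; apply/min_idPr; rewrite ler_pdivlMr// mul1r. Qed.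

(** * Thickenings and the adversarial risk *)

Section thickening.
Context (R : realType) (X : pmetricType R).
Implicit Types (B : set (borel X)) (e : R).

(** For [e > 0] its indicator is the supremum of [\1_B] over balls, and it is open for every [B]; so
    the integrands of [AdvRisk] become indicators of Borel sets. *)
Definition thickening e B : set (borel X) := \bigcup_(y in B) ball y e.

Lemma measurable_thickening e B : measurable (thickening e B).
Proof.
by apply: measurable_open; apply: bigcup_open => y _; exact: metric_ball_open.
Qed.

Lemma sub_thickening e B : 0 < e -> B `<=` thickening e B.
Proof. by move=> e0 x Bx; exists x => //; exact: ballxx. Qed.

Lemma ereal_sup_indic_ball e B (x : borel X) : 0 < e ->
  ereal_sup [set (\1_B y : R)%:E | y in ball x e] = (\1_(thickening e B) x)%:E.
Proof.
move=> e0; apply/eqP; rewrite eq_le; apply/andP; split.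
  apply: ge_ereal_sup => _ [y xy <-]; rewrite lee_fin !indicE.
  case: (boolP (y \in B)) => //= /set_mem By.
  by rewrite mem_set//; exists y => //; exact: ball_sym.
rewrite indicE; case: (boolP (x \in _)) => [/set_mem[y By yx]|_].
  apply: ereal_sup_ubound; exists y; first exact: ball_sym.
  by rewrite indicE mem_set.
(* The centre belongs to the ball, so the supremum is at least 0 and not [-oo], its value on an
   empty set. *)
apply: le_ereal_sup_tmp; exists (\1_B x : R)%:E.
  by exists x => //; exact: ballxx.
by rewrite lee_fin indicE.
Qed.

Lemma AdvRiskE (mu : probability (borel X * bool)%type R) e B : 0 < e ->
  (AdvRisk mu e B =
   rho_ mu false (thickening e B) + rho_ mu true (thickening e (~` B)))%E.
Proof.
move=> e0; rewrite /AdvRisk; congr (_ + _)%E.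
  under eq_integral do rewrite ereal_sup_indic_ball//.
  by rewrite integral_indic ?setIT//; exact: measurable_thickening.
under eq_integral do rewrite ereal_sup_indic_ball//.
by rewrite integral_indic ?setIT//; exact: measurable_thickening.
Qed.

End thickening.

(** * Integrals of [Psi_p] of a kernel *)

Section kernel_risk.
Local Open Scope ereal_scope.
Context (R : realType) (X : pmetricType R) (m : R.-pker (borel X) ~> (borel X)).
Implicit Types (P : {measure set (borel X) -> \bar R}) (B S : set (borel X)).

Lemma kernel_fin_num x B : measurable B -> m x B \is a fin_num.
Proof. exact: finite_kernel_measure. Qed.

Lemma Psi_kernel_ge0 p x B : (0 < p)%R -> 0 <= (Psi_ p (fine (m x B)))%:E.
Proof.
move=> p0; rewrite lee_fin.
by case/andP: (Psi_bounds p0 (fine_ge0 (measure_ge0 (m x) B))).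
Qed.

Lemma Psi_kernel_le1 p x B : (0 < p)%R -> (Psi_ p (fine (m x B)))%:E <= 1.
Proof.
move=> p0; rewrite lee_fin.
by case/andP: (Psi_bounds p0 (fine_ge0 (measure_ge0 (m x) B))).
Qed.

Lemma measurable_Psi_kernel D p B : measurable B ->
  measurable_fun D (fun x => (Psi_ p (fine (m x B)))%:E).
Proof.
move=> mB; apply: measurable_funTS; apply/measurable_EFinP.
apply: measurable_minr => //.
apply: measurable_funM => //.
apply: (measurableT_comp (fine_measurable measurableT)).
exact: measurable_kernel.
Qed.

Lemma measurable_kernel_gt0 B : measurable B ->
  measurable [set x | 0 < m x B].
Proof.
move=> mB; rewrite -[X in measurable X]setTI.
by apply: emeasurable_fun_o_infty => //; exact: measurable_kernel.
Qed.

(* For [x] in [S], [m x] lives on the ball around [x], so it charges [B] only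
   if [x] is in the thickening of [B]. *)
Lemma integral_Psi_kernel_le P S D e p B : measurable S -> P (~` S) = 0 ->
  (forall x, S x -> m x (~` ball x e) = 0) -> (0 < p)%R ->
  measurable D -> measurable B ->
  \int[P]_(x in D) (Psi_ p (fine (m x B)))%:E <= P (thickening e B `&` D).
Proof.
move=> mS PS mball p0 mD mB.
have mtS : measurable (thickening e B `|` ~` S).
  by apply: measurableU; [exact: measurable_thickening|exact: measurableC].
(* The hypothesis on balls says nothing outside [S], so the null complement of [S] is adjoined
   first. *)
apply: (@le_trans _ _ (P ((thickening e B `|` ~` S) `&` D))); last first.
  rewrite setIUl measureU0//.
  - by apply: measurableI => //; exact: measurable_thickening.
  - by apply: measurableI => //; exact: measurableC.
  - apply: subset_measure0 PS => //; last exact: measurableC.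
    by apply: measurableI => //; exact: measurableC.
rewrite -integral_indic//; apply: ge0_le_integral => //.
- by move=> x _; exact: Psi_kernel_ge0.
- exact: measurable_Psi_kernel.
- by apply/measurable_EFinP; exact: measurable_indic.
move=> x Dx; rewrite indicE.
case: (boolP (x \in _)) => [_|/negP]; first exact: Psi_kernel_le1.
rewrite inE => /not_orP[xB]; rewrite notK => Sx.
suff -> : m x B = 0 by rewrite Psi_0.
apply: subset_measure0 (mball _ Sx) => //.
  by apply: measurableC; exact: measurable_metric_ball.
by move=> y By xy; apply: xB; exists y => //; exact: ball_sym.
Qed.

(** Fatou's lemma: at [x] in [S] with [m x A > 0], eventually [p_ n <= m x A / 2 <= m x (A_ n)], so
    the integrand equals 1 there. *)
Lemma kernel_gt0_le_limn_einf P S (p_ : nat -> R) (A_ : nat -> set (borel X)) A :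
  measurable S -> P (~` S) = 0 ->
  (forall n, (0 < p_ n)%R) -> p_ n @[n --> \oo] --> (0 : R)%R ->
  (forall n, measurable (A_ n)) -> measurable A ->
  (forall x, S x -> fine (m x (A_ n)) @[n --> \oo] --> fine (m x A)) ->
  P [set x : borel X | 0 < m x A] <=
    limn_einf (fun n => \int[P]_x (Psi_ (p_ n) (fine (m x (A_ n))))%:E).
Proof.
move=> mS PS p0 p_0 mA_ mA cvgA.
have mG := measurable_kernel_gt0 mA.
pose G := [set x : borel X | 0 < m x A].
rewrite -/G; have -> : P G = P (G `&` S).
  rewrite (measureDI P mG mS) [X in X + _](_ : _ = 0) ?add0e//.
  apply: subset_measure0 PS; [exact: measurableD|exact: measurableC|].
  by move=> x [].
have mGS := measurableI _ _ mG mS.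
rewrite -[leLHS](_ : \int[P]_x (\1_(G `&` S) x)%:E = _); last first.
  by rewrite integral_indic// setIT.
apply: le_trans; last first.
  apply: fatou => //.
  - by move=> n; exact: measurable_Psi_kernel.
  - by move=> n x _; exact: Psi_kernel_ge0.
have einf_ge0 x : 0 <= limn_einf (fun n => (Psi_ (p_ n) (fine (m x (A_ n))))%:E).
  rewrite limn_einf_lim; apply: lime_ge; first exact: is_cvg_einfs.
  apply: nearW => n; apply: le_ereal_inf_tmp => _ [k _ <-].
  exact: Psi_kernel_ge0.
apply: ge0_le_integral => //.
- by apply/measurable_EFinP; exact: measurable_indic.
- by apply: measurable_fun_limn_einf => n; exact: measurable_Psi_kernel.
move=> x _; rewrite indicE; case: (boolP (x \in _)) => // /set_mem[/= xA Sx].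
suff : (Psi_ (p_ n) (fine (m x (A_ n))))%:E @[n --> \oo] --> 1%:E.
  by move=> /cvg_limn_einf_sup[-> _].
apply: cvg_near_cst.
have c0 : (0 < fine (m x A) / 2)%R.
  by rewrite divr_gt0// fine_gt0// xA ltey_eq kernel_fin_num.
near=> n; congr EFin; apply: Psi_1 => //.
apply: (@le_trans _ _ (fine (m x A) / 2)%R).
  by near: n; exact: (cvgr_le 0%R).
near: n; apply: (cvgr_ge (fine (m x A))); first exact: cvgA.
by rewrite ltr_pdivrMr// mulr2n mulrDr mulr1 ltrDl -(@pmulr_lgt0 _ 2^-1).
Unshelve. all: by end_near.
Qed.

End kernel_risk.

(** * Null sets of [nu], [rho] and the kernel *)

Section adversarial_limit.
Local Open Scope ereal_scope.
Context (R : realType) (X : pmetricType R)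
  (mu : probability (borel X * bool)%type R)
  (m : R.-pker (borel X) ~> (borel X)) (eps : R).

Local Notation S := (msupport (rho mu)).

Hypotheses (rho_supp : rho mu (~` S) = 0) (eps_gt0 : (0 < eps)%R)
  (m_ball : forall x, S x -> m x (~` ball x eps) = 0)
  (m_supp : forall x, S x -> ball x eps `<=` msupport (m x))
  (m_ac : forall x, S x -> forall x', S x' ->
    mrestr (m x') (measurable_metric_ball x eps) `<< m x)
  (rho_ac : forall x, S x ->
    mrestr (rho mu) (measurable_metric_ball x eps) `<< m x).

Let mS : measurable S.
Proof.
by rewrite -(setCK S); apply: measurableC; exact: measurable_setC_msupport.
Qed.

Let rhoE B : rho mu B = rho_ mu false B + rho_ mu true B.
Proof. exact: measure_addE. Qed.

Let rho_iS i : rho_ mu i (~` S) = 0.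
Proof.
move: rho_supp; rewrite rhoE => /eqP.
by rewrite padde_eq0 ?measure_ge0//; case: i => /andP[/eqP ? /eqP ?].
Qed.

Let rhoT : rho mu setT < +oo.
Proof.
by rewrite rhoE lte_add_pinfty// (le_lt_trans (probability_le1 mu _))//
  ?ltry//; exact: measurableX.
Qed.

Let nuT : nu mu m setT < +oo.
Proof.
rewrite /nu; under eq_integral do rewrite prob_kernel.
rewrite integral_cst// mul1e -muleDr// ?fin_num_adde_defl ?ge0_fin_numE//.
by rewrite lte_mul_pinfty// ?adde_ge0// ?lee_fin ?invr_ge0// lte_add_pinfty.
Qed.

Let m_ac_ball x x' B : S x -> S x' -> measurable B -> m x B = 0 ->
  m x' (B `&` ball x eps) = 0.
Proof.
move=> Sx Sx' mB xB.
have /null_content_dominatesP/(_ B mB xB) := m_ac Sx Sx'; exact.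
Qed.

Let rho_ac_ball x B : S x -> measurable B -> m x B = 0 ->
  rho mu (B `&` ball x eps) = 0.
Proof.
move=> Sx mB xB.
have /null_content_dominatesP/(_ B mB xB) := rho_ac Sx; exact.
Qed.

Let nu_null B : measurable B -> rho mu B = 0 ->
  (forall x, S x -> m x B = 0) -> nu mu m B = 0.
Proof.
move=> mB rhoB mB0; rewrite /nu rhoB mule0 adde0.
rewrite (ge0_negligible_integral _ _ _ _ rho_supp)//; last 2 first.
- exact: measurableC.
- exact: measurable_kernel.
by rewrite integral0_eq ?mule0// => x [_ /contrapT/mB0].
Qed.

(* A [nu]-null set is [m x']-null for points [x'] of the support arbitrarily
   close to [x]; the balls around such points cover the ball around [x]. *)
Lemma kernel_null_dominates x : S x -> m x `<< nu mu m.
Proof.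
move=> Sx; apply/null_content_dominatesP => B mB.
rewrite /nu => /eqP; rewrite padde_eq0; last 2 first.
- by rewrite mule_ge0 ?lee_fin ?invr_ge0// integral_ge0.
- by rewrite mule_ge0 ?lee_fin ?invr_ge0.
move=> /andP[+ _]; rewrite mule_eq0 eqe invr_eq0 pnatr_eq0/= => /eqP mB0.
have mmB := measurable_kernel m _ mB.
have /ae_eq_integral_abs : \int[rho mu]_x' `|m x' B| = 0.
  by rewrite -[RHS]mB0; apply: eq_integral => y _; rewrite gee0_abs.
move=> /(_ measurableT mmB)[N [mN N0 NB]].
(* Outside the [rho]-null set [N], [m x' B = 0]. A ball around the support point [x] has positive
   mass, hence contains such an [x'] in [S]. *)
have near_x (n : nat) :
    exists x', [/\ S x', ball x (n.+1%:R^-1 : R) x' & m x' B = 0].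
  apply: contrapT => noy.
  have : 0 < rho mu (ball x (n.+1%:R^-1 : R)).
    by apply: Sx; [exact: metric_ball_open|apply: ballxx; rewrite invr_gt0].
  apply/negP; rewrite -leNgt.
  have NS0 : rho mu (N `|` ~` S) = 0.
    by rewrite measureU0//; exact: measurableC.
  rewrite -[leRHS]NS0 le_measure ?inE//.
  - exact: measurable_metric_ball.
  - by apply: measurableU => //; exact: measurableC.
  move=> y xy; apply: contrapT => /not_orP[Ny] /contrapT Sy.
  apply: noy; exists y; split => //.
  by apply: contrapT => yB; apply: Ny; apply: NB => /= /(_ Logic.I).
have [x' x'P] := choice near_x.
have mBb z : measurable (B `&` ball z eps).
  by apply: measurableI => //; exact: measurable_metric_ball.
have mBU : measurable (\bigcup_n (B `&` ball (x' n) eps)).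
  by apply: bigcupT_measurable => n; exact: mBb.
have mcb : measurable (~` ball x eps).
  by apply: measurableC; exact: measurable_metric_ball.
have BU0 : m x (\bigcup_n (B `&` ball (x' n) eps)) = 0.
  apply/(measure0_null_setP _ mBU); apply: negligible_null_set.
  apply: negligible_bigcup => n; exists (B `&` ball (x' n) eps); split => //.
  by have [Sx' _ x'B] := x'P n; exact: m_ac_ball.
have : m x (\bigcup_n (B `&` ball (x' n) eps) `|` ~` ball x eps) = 0.
  by rewrite measureU0// m_ball.
apply: subset_measure0 => //; first exact: measurableU.
move=> y By; have [xy|xy] := pselect (ball x eps y); [left|by right].
move: xy; rewrite ballEmdist/= => xy.
have d0 : (0 < eps - mdist x y)%R by rewrite subr_gt0.
(* [1/(n+1)] is below the slack [eps - mdist x y], so the ball around [x' n] still contains [y]. *)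
pose n := Num.truncn (eps - mdist x y)^-1.
exists n => //; split=> //; rewrite ballEmdist/=.
have [_ + _] := x'P n; rewrite ballEmdist/= metric_sym => x'x.
rewrite (le_lt_trans (metric_triangle _ x _))// -ltrBrDr (lt_trans x'x)//.
by rewrite invf_plt ?posrE// truncnS_gt.
Qed.

(** * Comparison of the risks and passage to the limit *)

(** As [Psi_p] is at most 1, its integral over a set is at most the mass of that set. *)
Lemma Risk_le_ProbRisk p B : (0 < p)%R -> measurable B ->
  Risk mu m (Psi_ p) B <= ProbRisk mu m (Psi_ p) B.
Proof.
move=> p0 mB.
have le_split (P : {measure set (borel X) -> \bar R}) D C :
    measurable C -> measurable D ->
    \int[P]_x (Psi_ p (fine (m x C)))%:E <=
    P D + \int[P]_(x in ~` D) (Psi_ p (fine (m x C)))%:E.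
  move=> mC mD; rewrite -(setUv D) ge0_integral_setU//; last 4 first.
  - exact: measurableC.
  - exact: measurable_Psi_kernel.
  - by move=> x _; exact: Psi_kernel_ge0.
  - exact/disj_setPCl.
  apply: leeD => //; rewrite -[leRHS]mul1e -integral_cst//.
  apply: ge0_le_integral => //.
  - by move=> x _; exact: Psi_kernel_ge0.
  - exact: measurable_Psi_kernel.
  - by move=> x _; exact: Psi_kernel_le1.
rewrite /ProbRisk -addeA addeACA; apply: leeD; first exact: le_split.
have mCB := measurableC mB.
by have := le_split (rho_ mu true) _ _ mCB mCB; rewrite setCK.
Qed.

(** A thickening splits into the set itself, which carries the misclassified mass, and the rest,
    whose mass bounds the integral of [Psi_p]. *)
Lemma ProbRisk_le_AdvRisk p B : (0 < p)%R -> measurable B ->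
  ProbRisk mu m (Psi_ p) B <= AdvRisk mu eps B.
Proof.
move=> p0 mB; rewrite AdvRiskE//.
have le_thickening i C : measurable C ->
    rho_ mu i C + \int[rho_ mu i]_(x in ~` C) (Psi_ p (fine (m x C)))%:E <=
    rho_ mu i (thickening eps C).
  move=> mC; rewrite [leRHS](measureDI _ _ mC); last exact: measurable_thickening.
  rewrite [X in _ <= _ + _ X](_ : _ = C); last first.
    by apply/setIidr; exact: sub_thickening.
  rewrite addeC setDE; apply: leeD => //.
  apply: (integral_Psi_kernel_le mS) => //; first exact: rho_iS.
  exact: measurableC.
rewrite /ProbRisk -addeA addeACA; apply: leeD; first exact: le_thickening.
by have := le_thickening true _ (measurableC mB); rewrite setCK.
Qed.

(** [J] stands for either risk. Minimality enters through the chain [Risk (A_p) <= J (A_p) <= J B <=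
    AdvRisk B], whose left end is bounded below in the limit. *)
Lemma limit_risk_le_AdvRisk (J : R -> set (borel X) -> \bar R)
    (A_ : R -> set (borel X)) (A : set (borel X)) :
  (forall p B, (0 < p)%R -> measurable B -> Risk mu m (Psi_ p) B <= J p B) ->
  (forall p B, (0 < p)%R -> measurable B -> J p B <= AdvRisk mu eps B) ->
  (forall p, (0 < p)%R -> is_minimizer (J p) (A_ p)) -> measurable A ->
  weak_star_cvg (nu mu m) 0^'+ (fun p => \1_(A_ p)) \1_A ->
  forall B, measurable B ->
    rho_ mu false [set x | 0 < m x A] +
      rho_ mu true [set x | 0 < m x (~` A)] <=
    AdvRisk mu eps B.
Proof.
move=> RiskJ JAdv minA mA A_A B mB.
(* Fatou's lemma is applied to a sequence, so [p] runs through [1/(n+1)]. *)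
pose p_ n : R := n.+1%:R^-1%R.
have p_gt0 n : (0 < p_ n)%R by rewrite invr_gt0.
have p_0 : p_ n @[n --> \oo] --> (0 : R)%R by exact: cvg_harmonic.
have mA_ n : measurable (A_ (p_ n)) by have [] := minA _ (p_gt0 n).
have cvgm x : S x -> fine (m x (A_ (p_ n))) @[n --> \oo] --> fine (m x A).
  move=> Sx.
  have : fine (m x (A_ p)) @[p --> 0^'+] --> fine (m x A).
    apply: (weak_star_cvg_null_dominates (Q := nu mu m)) => //.
    - by rewrite prob_kernel ltry.
    - exact: kernel_null_dominates.
    - by near=> p; have [] := minA p _.
  by move=> /cvg_at_rightP; apply.
(* Since [m x] has mass 1, convergence passes to the complements. *)
have fine_mC x C : measurable C -> fine (m x (~` C)) = (1 - fine (m x C))%R.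
  have mT : m x setT = 1 := prob_kernel x.
  move=> mC; have -> : m x (~` C) = 1 - m x C.
    have mTy : m x setT < +oo by rewrite mT ltry.
    by rewrite -setTD measureD// setTI; congr (_ - _).
  by rewrite fineB// kernel_fin_num.
have cvgmC x : S x ->
    fine (m x (~` A_ (p_ n))) @[n --> \oo] --> fine (m x (~` A)).
  move=> Sx; rewrite fine_mC//.
  under eq_fun do rewrite fine_mC//.
  by apply: cvgB; [exact: cvg_cst|exact: cvgm].
pose u i (C : nat -> set (borel X)) n :=
  \int[rho_ mu i]_x (Psi_ (p_ n) (fine (m x (C n))))%:E.
have u_ge0 i C n : 0 <= u i C n.
  by apply: integral_ge0 => x _; exact: Psi_kernel_ge0.
apply: (@le_trans _ _ (limn_einf (u false (A_ \o p_)) +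
    limn_einf (u true (fun n => ~` A_ (p_ n))))).
  apply: leeD; apply: (kernel_gt0_le_limn_einf mS) => //.
  - exact: rho_iS.
  - exact: rho_iS.
  - by move=> n; exact: measurableC.
  - exact: measurableC.
apply: limn_einf_add_le => // n.
apply: (@le_trans _ _ (J (p_ n) (A_ (p_ n)))); first exact: RiskJ (p_gt0 n) (mA_ n).
apply: (@le_trans _ _ (J (p_ n) B)); last exact: JAdv (p_gt0 n) mB.
by have [_ minAn] := minA _ (p_gt0 n); exact: minAn.
Unshelve. all: by end_near.
Qed.

(** * Modification on a [nu]-null set *)

Let U A : set (borel X) := \bigcup_(x in [set x | S x /\ m x A = 0]) ball x eps.

Let mU A : measurable (U A).
Proof.
by apply: measurable_open; apply: bigcup_open => x _; exact: metric_ball_open.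
Qed.

(** Countably many balls suffice. In the ball around such an [x], the part of [A] is [m x]-null,
    hence by absolute continuity null for [rho] and for every [m x'] with [x'] in [S]. *)
Lemma nu_vanishing_balls A : measurable A -> nu mu m (A `&` U A) = 0.
Proof.
move=> mA; pose E : set (borel X) := [set x | S x /\ m x A = 0].
have [|D [/countable_injP[f finj] DE Ddense]] :=
  @msupport_separable _ _ (rho mu) E rhoT; first by move=> x [].
have UD : U A `<=` \bigcup_(x in D) ball x eps.
  move=> y [x Ex]; rewrite ballEmdist/= => xy.
  have d0 : (0 < eps - mdist x y)%R by rewrite subr_gt0.
  have [z Dz] := Ddense x _ Ex d0; rewrite ballEmdist/= metric_sym => xz.
  exists z => //; rewrite ballEmdist/= (le_lt_trans (metric_triangle _ x _))//.
  by rewrite -ltrBrDr.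
have mAU : measurable (A `&` U A) by exact: measurableI.
apply/(measure0_null_setP _ mAU); apply: negligible_null_set.
(* Centres are indexed by their values under the injection [f], so each [n] carries at most one
   ball. *)
apply: (@negligibleS _ _ _ (nu mu m)
  (\bigcup_n [set y | exists x, [/\ D x, f x = n & (A `&` ball x eps) y]])).
  by move=> y [Ay /UD[x Dx xy]]; exists (f x) => //; exists x.
apply: negligible_bigcup => n.
have [[x [Dx fxn]]|nox] := pselect (exists x, D x /\ f x = n); last first.
  exists set0; split=> // y [x [Dx fx _]].
  by apply: nox; exists x.
have [Sx xA] := DE _ Dx.
have mAb : measurable (A `&` ball x eps).
  by apply: measurableI => //; exact: measurable_metric_ball.
exists (A `&` ball x eps); split => //.
  apply: nu_null => //; first exact: rho_ac_ball.
  by move=> x' Sx'; exact: m_ac_ball.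
move=> y [x' [Dx' fx'n x'y]].
by rewrite (finj x x') ?inE// fxn fx'n.
Qed.

(* Were a point in both unions, two balls around support points [x], [x'] would
   meet; by [m_supp] the ball around [x] would be charged by [m x'], although
   [m_ac] makes both [A] and its complement [m x']-null there. *)
Lemma vanishing_balls_disjoint A : measurable A -> U A `&` U (~` A) = set0.
Proof.
move=> mA; rewrite -subset0 => y [[x [Sx xA] xy] [x' [Sx' x'A] x'y]].
have mCA := measurableC mA.
have mb := measurable_metric_ball x eps.
have : 0 < m x' (ball x eps).
  by apply: (m_supp Sx' x'y) => //; exact: metric_ball_open.
have mAb : measurable (A `&` ball x eps) by exact: measurableI.
have AbC0 : m x' ((A `&` ball x eps) `|` ~` A) = 0.
  by rewrite measureU0// m_ac_ball.
suff -> : m x' (ball x eps) = 0 by rewrite ltxx.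
apply: subset_measure0 AbC0 => //; first exact: measurableU.
by move=> z xz; have [Az|nAz] := pselect (A z); [left|right].
Qed.

(** The new set misses [U A], so a point [x] of [S] whose ball meets it has [m x A > 0]. The same
    holds for the complements, which bounds both thickenings in [AdvRisk]. *)
Lemma AdvRisk_minimizer_modification A : measurable A ->
  (forall B, measurable B ->
    rho_ mu false [set x | 0 < m x A] +
      rho_ mu true [set x | 0 < m x (~` A)] <=
    AdvRisk mu eps B) ->
  exists A', [/\ measurable A', nu mu m (A' `+` A) = 0 &
                 is_minimizer (AdvRisk mu eps) A'].
Proof.
move=> mA lowerA; have mCA := measurableC mA.
have disj := vanishing_balls_disjoint mA.
pose A' := (A `\` U A) `|` U (~` A).
have mA' : measurable A' by apply: measurableU => //; exact: measurableD.
exists A'; split => //.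
  have mAU : measurable (A `&` U A) by exact: measurableI.
  have mCAU : measurable (~` A `&` U (~` A)) by exact: measurableI.
  have : nu mu m ((A `&` U A) `|` (~` A `&` U (~` A))) = 0.
    by rewrite measureU0//; exact: nu_vanishing_balls.
  apply: subset_measure0.
  - by apply: measurableU; exact: measurableD.
  - exact: measurableU.
  - move=> y [[[[Ay _]|Uy] nAy]|[Ay /not_orP[nAUy _]]] //.
      by right.
    by left; split => //; apply: contrapT => nUy; apply: nAUy.
split => // B mB; apply: le_trans (lowerA B mB); rewrite AdvRiskE//.
have le_gt0 i C C' : measurable C -> C' `&` U C = set0 ->
    rho_ mu i (thickening eps C') <= rho_ mu i [set x | 0 < m x C].
  move=> mC C'U; have mG := measurable_kernel_gt0 m mC.
  have mCS := measurableC mS.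
  rewrite -(measureU0 mG mCS (rho_iS i)) le_measure ?inE//.
  - exact: measurable_thickening.
  - exact: measurableU.
  move=> x [y C'y yx]; have [Sx|] := pselect (S x); [left|by right].
  rewrite /= lt0e measure_ge0 andbT; apply/eqP => xC.
  have : (C' `&` U C) y by split => //; exists x => //; exact: ball_sym.
  by rewrite C'U.
(* The first case uses disjointness of the two unions, since points were added to [A]; the second is
   immediate from the construction. *)
apply: leeD; apply: le_gt0 => //; rewrite -subset0 => y.
- move=> [[[_ nU]//|Uy] U'y].
  by have : (U A `&` U (~` A)) y by []; rewrite disj.
- by move=> [/not_orP[_ nU]].
Qed.

End adversarial_limit.

Theorem theorem7 (R : realType) (X : pmetricType R)
    (mu : probability (borel X * bool)%type R)
    (m : R.-pker (borel X) ~> (borel X)) (eps : R)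
    (rho_supp : rho mu (~` msupport (rho mu)) = 0%E)
    (eps_gt0 : 0 < eps)
    (m_ball : forall x, msupport (rho mu) x -> m x (~` ball x eps) = 0%E)
    (m_supp : forall x, msupport (rho mu) x ->
      ball x eps `<=` msupport (m x))
    (m_ac : forall x, msupport (rho mu) x ->
      forall x', msupport (rho mu) x' ->
      mrestr (m x') (measurable_metric_ball x eps) `<< m x)
    (rho_ac : forall x, msupport (rho mu) x ->
      mrestr (rho mu) (measurable_metric_ball x eps) `<< m x) :
  (forall (A_ : R -> set (borel X)) (A : set (borel X)),
    (forall p, 0 < p -> is_minimizer (ProbRisk mu m (Psi_ p)) (A_ p)) ->
    measurable A ->
    weak_star_cvg (nu mu m) 0^'+ (fun p => \1_(A_ p)) \1_A ->
    exists A', [/\ measurable A', nu mu m (A' `+` A) = 0%E &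
                   is_minimizer (AdvRisk mu eps) A']) /\
  (forall (A_ : R -> set (borel X)) (A : set (borel X)),
    (forall p, 0 < p -> is_minimizer (Risk mu m (Psi_ p)) (A_ p)) ->
    measurable A ->
    weak_star_cvg (nu mu m) 0^'+ (fun p => \1_(A_ p)) \1_A ->
    exists A', [/\ measurable A', nu mu m (A' `+` A) = 0%E &
                   is_minimizer (AdvRisk mu eps) A']).

Proof.
(* One argument serves both assertions, with [J p] equal to [ProbRisk] or [Risk]. *)
have min_limit (J : R -> set (borel X) -> \bar R) :
    (forall p B, 0 < p -> measurable B -> (Risk mu m (Psi_ p) B <= J p B)%E) ->
    (forall p B, 0 < p -> measurable B -> (J p B <= AdvRisk mu eps B)%E) ->
    forall A_ A, (forall p, 0 < p -> is_minimizer (J p) (A_ p)) ->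
    measurable A -> weak_star_cvg (nu mu m) 0^'+ (fun p => \1_(A_ p)) \1_A ->
    exists A', [/\ measurable A', nu mu m (A' `+` A) = 0%E &
                   is_minimizer (AdvRisk mu eps) A'].
  move=> RiskJ JAdv A_ A minA mA A_A.
  have lowerA :=
    limit_risk_le_AdvRisk rho_supp m_ball m_ac RiskJ JAdv minA mA A_A.
  exact: AdvRisk_minimizer_modification lowerA.
split; apply: min_limit => // p B p0 mB.
- exact: Risk_le_ProbRisk.
- exact: ProbRisk_le_AdvRisk.
- exact: le_trans (Risk_le_ProbRisk _ _ p0 mB) (ProbRisk_le_AdvRisk _ _ _ p0 mB).
Qed.
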